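(* The functor $\mathbb{V}:\mathbf{Cat}\to\mathbf{DblCat}$ preserves and reflects weak equivalences, fibrations, and cofibrations: a functor $F$ is a weak equivalence (respectively fibration, respectively cofibration) in the Thomason model structure on $\mathbf{Cat}$ if and only if $\mathbb{V}F$ is a weak equivalence (respectively fibration, respectively cofibration) in the transferred diagram Thomason model structure on $\mathbf{DblCat}$. As a consequence, the transferred diagram Thomason model structure on $\mathbf{DblCat}$ extends the Thomason model structure on $\mathbf{Cat}$ as a vertically embedded subcategory.
   Context: A small double category $\mathbb{D}$ is an internal category in $\mathbf{Cat}$: it consists of a category $\mathbb{D}_0$ (objects and vertical morphisms), a category $\mathbb{D}_1$ (horizontal morphisms and squares, composed vertically), and source, target, unit and horizontal composition functors satisfying the category axioms. $\mathbf{DblCat}$ is the category of small double categories and double functors (internal functors). The vertical embedding $\mathbb{V}:\mathbf{Cat}\to\mathbf{DblCat}$ sends a category $\mathbf{C}$ to the double category whose vertical category is $\mathbf{C}$ and which has only identity horizontal morphisms and only the corresponding identity squares (i.e. $(\mathbb{V}\mathbf{C})_0=(\mathbb{V}\mathbf{C})_1=\mathbf{C}$ with $s,t,u$ identities). The horizontal nerve $N_h:\mathbf{DblCat}\to\mathbf{Cat}^{\Delta^{op}}$ sends $\mathbb{D}$ to the simplicial object in $\mathbf{Cat}$ with $(N_h\mathbb{D})_0=\mathbb{D}_0$, $(N_h\mathbb{D})_1=\mathbb{D}_1$, and $(N_h\mathbb{D})_n=\mathbb{D}_1\times_{\mathbb{D}_0}\cdots\times_{\mathbb{D}_0}\mathbb{D}_1$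 ($n$ copies). In the Thomason model structure on $\mathbf{Cat}$, a functor $F$ is a weak equivalence (respectively fibration) if and only if $\mathrm{Ex}^2NF$ is a weak equivalence (respectively Kan fibration) of simplicial sets, where $N$ is the nerve and $\mathrm{Ex}$ is the right adjoint of barycentric subdivision $\mathrm{Sd}$. The transferred diagram Thomason model structure on $\mathbf{DblCat}$ is the (existing) cofibrantly generated model structure in which a double functor $K$ is a weak equivalence (respectively fibration) if and only if each $(N_hK)_n$, $n\ge0$, is a weak equivalence (respectively fibration) in the Thomason model structure on $\mathbf{Cat}$; cofibrations are the double functors with the left lifting property with respect to the maps that are both weak equivalences and fibrations. *)

(* Defs.v *)
From HB Require Import structures.
From Stdlib Require Import Relation_Operators.
From mathcomp Require Import all_boot all_order all_algebra.
From mathcomp Require Import generic_quotient.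
From mathcomp Require Import all_classical all_reals all_analysis.

Set Implicit Arguments.
Unset Strict Implicit.
Unset Printing Implicit Defensive.

Import Order.TTheory GRing.Theory Num.Theory.
Import numFieldNormedType.Exports.

(* [category] is for the large categories Cat, DblCat and SSet; the small      *)
(* categories, which are the objects of Cat, are the type [smallcat] below.    *)

Record category := Category {
  ob : Type;
  hom : ob -> ob -> Type;
  cid : forall A, hom A A;
  ccomp : forall A B C, hom B C -> hom A B -> hom A C;
  ccompidl : forall A B (f : hom A B), ccomp (cid B) f = f;
  ccompidr : forall A B (f : hom A B), ccomp f (cid A) = f;
  ccompA : forall A B C D (h : hom C D) (g : hom B C) (f : hom A B),
    ccomp h (ccomp g f) = ccomp (ccomp h g) f
}.
Arguments hom {c}.
Arguments cid {c}.
Arguments ccomp {c A B C}.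

Record Functor (M N : category) := MkFunctor {
  Fob :> ob M -> ob N;
  Fhom : forall A B, hom A B -> hom (Fob A) (Fob B);
  Fhom_id : forall A, Fhom (cid A) = cid (Fob A);
  Fhom_comp : forall A B C (g : hom B C) (f : hom A B),
    Fhom (ccomp g f) = ccomp (Fhom g) (Fhom f)
}.
Arguments Fhom {M N} _ {A B}.

Definition llp (M : category) (A B X Y : ob M) (i : hom A B) (p : hom X Y) :=
  forall (u : hom A X) (v : hom B Y), ccomp p u = ccomp v i ->
  exists h : hom B X, ccomp h i = u /\ ccomp p h = v.

Definition full_embedding (M N : category) (F : Functor M N) :=
  injective F /\ forall A B : ob M, bijective (@Fhom _ _ F A B).

Definition hom_class (M : category) := forall A B : ob M, hom A B -> Prop.

Record model_classes (M : category) := ModelClasses {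
  weq : hom_class M;
  fib : hom_class M;
  cof : hom_class M
}.
Arguments weq {M} _ {A B}.
Arguments fib {M} _ {A B}.
Arguments cof {M} _ {A B}.

(* In a model structure the cofibrations are determined by the weak           *)
(* equivalences and the fibrations.                                           *)
Definition model_of_weq_fib (M : category) (W F : hom_class M) :=
  ModelClasses W F
    (fun A B (i : hom A B) =>
       forall (X Y : ob M) (p : hom X Y), W _ _ p -> F _ _ p -> llp i p).

Definition restrict_classes (M N : category) (V : Functor M N)
    (S : model_classes N) : model_classes M :=
  ModelClasses (fun A B (f : hom A B) => weq S (Fhom V f))
               (fun A B (f : hom A B) => fib S (Fhom V f))
               (fun A B (f : hom A B) => cof S (Fhom V f)).

(* The structure on N restricts along the full embedding V to the one on M.   *)
Definition extends_along (M N : category) (V : Functor M N)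
    (SN : model_classes N) (SM : model_classes M) :=
  full_embedding V /\ restrict_classes V SN = SM.

(* A small category is given by a set of objects and a set of morphisms with  *)
(* domain and codomain maps, so that equality of functors is equality of the  *)
(* two underlying functions (lemma functor_eq).  Composition [comp g f e] is  *)
(* "g after f".                                                               *)

Record smallcat := SmallCat {
  Ob : Type;
  Mor : Type;
  dom : Mor -> Ob;
  cod : Mor -> Ob;
  idm : Ob -> Mor;
  comp : forall g f : Mor, dom g = cod f -> Mor;
  dom_id : forall x, dom (idm x) = x;
  cod_id : forall x, cod (idm x) = x;
  dom_comp : forall g f e, dom (@comp g f e) = dom f;
  cod_comp : forall g f e, cod (@comp g f e) = cod g;
  comp_idl : forall x f e, @comp (idm x) f e = f;
  comp_idr : forall f x e, @comp f (idm x) e = f;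
  comp_assoc : forall h g f e1 e2 e3 e4,
    @comp h (@comp g f e1) e2 = @comp (@comp h g e3) f e4
}.
Arguments dom {s}.
Arguments cod {s}.
Arguments idm {s}.
Arguments comp {s} g f e.

Record functor (C D : smallcat) := MkFun {
  fob :> Ob C -> Ob D;
  fmor : Mor C -> Mor D;
  fdom : forall f, dom (fmor f) = fob (dom f);
  fcod : forall f, cod (fmor f) = fob (cod f);
  fid : forall x, fmor (idm x) = idm (fob x);
  fcomp : forall g f e e', fmor (comp g f e) = comp (fmor g) (fmor f) e'
}.

Arguments fcomp {C D} _ {g f} e e'.

Lemma functor_eq C D (F G : functor C D) :
  fob F = fob G -> fmor F = fmor G -> F = G.
Proof.
case: F G => [Fo Fm a b c d] [Go Gm a' b' c' d'] /= eo em.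
by move: a b c d a' b' c' d'; rewrite eo em => *; f_equal; exact: Prop_irrelevance.
Qed.

Lemma comp_congr (C : smallcat) (g f g' f' : Mor C) e e' :
  g = g' -> f = f' -> comp g f e = comp g' f' e'.
Proof. by move=> eg ef; subst; congr (comp _ _ _); exact: Prop_irrelevance. Qed.

Lemma idfun_comp (C : smallcat) (g f : Mor C) e e' :
  id (comp g f e) = comp (id g) (id f) e'.
Proof. exact: comp_congr. Qed.

Definition idfun_cat (C : smallcat) : functor C C :=
  @MkFun C C id id (fun=> erefl) (fun=> erefl) (fun=> erefl) (@idfun_comp C).

Section Compfun.
Variables (A B C : smallcat) (G : functor B C) (F : functor A B).

Lemma compfun_dom f : dom (fmor G (fmor F f)) = G (F (dom f)).
Proof. by rewrite !fdom. Qed.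

Lemma compfun_cod f : cod (fmor G (fmor F f)) = G (F (cod f)).
Proof. by rewrite !fcod. Qed.

Lemma compfun_id x : fmor G (fmor F (idm x)) = idm (G (F x)).
Proof. by rewrite !fid. Qed.

Lemma compfun_comp g f e e' :
  fmor G (fmor F (comp g f e)) = comp (fmor G (fmor F g)) (fmor G (fmor F f)) e'.
Proof.
have e1 : dom (fmor F g) = cod (fmor F f) by rewrite fdom fcod e.
by rewrite (fcomp F e e1); exact: fcomp.
Qed.

Definition compfun : functor A C :=
  @MkFun A C (fun x => G (F x)) (fun f => fmor G (fmor F f))
    compfun_dom compfun_cod compfun_id compfun_comp.

End Compfun.

Lemma compfunA A B C D (h : functor C D) (g : functor B C) (f : functor A B) :
  compfun h (compfun g f) = compfun (compfun h g) f.
Proof. exact: functor_eq. Qed.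

Lemma compfunidl A B (f : functor A B) : compfun (idfun_cat B) f = f.
Proof. exact: functor_eq. Qed.

Lemma compfunidr A B (f : functor A B) : compfun f (idfun_cat A) = f.
Proof. exact: functor_eq. Qed.

Definition CAT : category := Category compfunidl compfunidr compfunA.

Section Pullback.
Variables (A B C : smallcat) (F : functor A C) (G : functor B C).

Definition pbOb := {x : Ob A * Ob B | F x.1 = G x.2}.
Definition pbMor := {x : Mor A * Mor B | fmor F x.1 = fmor G x.2}.

Lemma sig_eq T (P : T -> Prop) (x y : {z | P z}) : sval x = sval y -> x = y.
Proof.
by case: x y => [x px] [y py] /= e; subst; congr exist; exact: Prop_irrelevance.
Qed.

Lemma pb_domP (f : pbMor) : F (dom (sval f).1) = G (dom (sval f).2).
Proof. by rewrite -!fdom (svalP f). Qed.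

Lemma pb_codP (f : pbMor) : F (cod (sval f).1) = G (cod (sval f).2).
Proof. by rewrite -!fcod (svalP f). Qed.

Lemma pb_idmP (x : pbOb) : fmor F (idm (sval x).1) = fmor G (idm (sval x).2).
Proof. by rewrite !fid (svalP x). Qed.

Definition pb_dom f : pbOb := exist _ (dom (sval f).1, dom (sval f).2) (pb_domP f).
Definition pb_cod f : pbOb := exist _ (cod (sval f).1, cod (sval f).2) (pb_codP f).
Definition pb_idm x : pbMor := exist _ (idm (sval x).1, idm (sval x).2) (pb_idmP x).

Lemma pb_comp1 g f : pb_dom g = pb_cod f -> dom (sval g).1 = cod (sval f).1.
Proof. by move=> /(congr1 (fun z => (sval z).1)). Qed.

Lemma pb_comp2 g f : pb_dom g = pb_cod f -> dom (sval g).2 = cod (sval f).2.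
Proof. by move=> /(congr1 (fun z => (sval z).2)). Qed.

Lemma pb_compP g f (e : pb_dom g = pb_cod f) :
  fmor F (comp (sval g).1 (sval f).1 (pb_comp1 e)) =
  fmor G (comp (sval g).2 (sval f).2 (pb_comp2 e)).
Proof.
have e1 : dom (fmor F (sval g).1) = cod (fmor F (sval f).1).
  by rewrite fdom fcod (pb_comp1 e).
have e2 : dom (fmor G (sval g).2) = cod (fmor G (sval f).2).
  by rewrite fdom fcod (pb_comp2 e).
rewrite (fcomp F _ e1) (fcomp G _ e2).
by apply: comp_congr; [exact: (svalP g)|exact: (svalP f)].
Qed.

Definition pb_comp g f (e : pb_dom g = pb_cod f) : pbMor :=
  exist _ (comp (sval g).1 (sval f).1 (pb_comp1 e),
           comp (sval g).2 (sval f).2 (pb_comp2 e)) (pb_compP e).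

Lemma pb_dom_id x : pb_dom (pb_idm x) = x.
Proof. by apply: sig_eq; rewrite /= !dom_id; case: (sval x). Qed.

Lemma pb_cod_id x : pb_cod (pb_idm x) = x.
Proof. by apply: sig_eq; rewrite /= !cod_id; case: (sval x). Qed.

Lemma pb_dom_comp g f e : pb_dom (@pb_comp g f e) = pb_dom f.
Proof. by apply: sig_eq; rewrite /= !dom_comp. Qed.

Lemma pb_cod_comp g f e : pb_cod (@pb_comp g f e) = pb_cod g.
Proof. by apply: sig_eq; rewrite /= !cod_comp. Qed.

Lemma pb_comp_idl x f e : @pb_comp (pb_idm x) f e = f.
Proof. by apply: sig_eq; rewrite /= !comp_idl; case: (sval f). Qed.

Lemma pb_comp_idr f x e : @pb_comp f (pb_idm x) e = f.
Proof. by apply: sig_eq; rewrite /= !comp_idr; case: (sval f). Qed.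

Lemma pb_comp_assoc h g f e1 e2 e3 e4 :
  @pb_comp h (@pb_comp g f e1) e2 = @pb_comp (@pb_comp h g e3) f e4.
Proof. by apply: sig_eq; congr pair; exact: comp_assoc. Qed.

Definition pullback : smallcat :=
  SmallCat pb_dom_id pb_cod_id pb_dom_comp pb_cod_comp
    pb_comp_idl pb_comp_idr pb_comp_assoc.

Lemma pb1_comp (g f : Mor pullback) e e' :
  (sval (comp g f e)).1 = comp (sval g).1 (sval f).1 e'.
Proof. exact: comp_congr. Qed.

Lemma pb2_comp (g f : Mor pullback) e e' :
  (sval (comp g f e)).2 = comp (sval g).2 (sval f).2 e'.
Proof. exact: comp_congr. Qed.

Definition pb1 : functor pullback A :=
  @MkFun pullback A (fun x => (sval x).1) (fun f => (sval f).1)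
    (fun=> erefl) (fun=> erefl) (fun=> erefl) pb1_comp.

Definition pb2 : functor pullback B :=
  @MkFun pullback B (fun x => (sval x).2) (fun f => (sval f).2)
    (fun=> erefl) (fun=> erefl) (fun=> erefl) pb2_comp.

End Pullback.

Section PullbackMap.
Variables (A B C A' B' C' : smallcat).
Variables (F : functor A C) (G : functor B C).
Variables (F' : functor A' C') (G' : functor B' C').
Variables (a : functor A A') (b : functor B B') (c : functor C C').
Hypothesis eF : compfun F' a = compfun c F.
Hypothesis eG : compfun G' b = compfun c G.

Lemma pbmap_obP (x : pbOb F G) : F' (a (sval x).1) = G' (b (sval x).2).
Proof.
have /= -> := congr1 (fun H => fob H (sval x).1) eF.
by have /= -> := congr1 (fun H => fob H (sval x).2) eG; rewrite (svalP x).
Qed.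

Lemma pbmap_morP (f : pbMor F G) :
  fmor F' (fmor a (sval f).1) = fmor G' (fmor b (sval f).2).
Proof.
have /= -> := congr1 (fun H => fmor H (sval f).1) eF.
by have /= -> := congr1 (fun H => fmor H (sval f).2) eG; rewrite (svalP f).
Qed.

Definition pbmap_ob x : pbOb F' G' :=
  exist _ (a (sval x).1, b (sval x).2) (pbmap_obP x).
Definition pbmap_mor f : pbMor F' G' :=
  exist _ (fmor a (sval f).1, fmor b (sval f).2) (pbmap_morP f).

Lemma pbmap_dom f : pb_dom (pbmap_mor f) = pbmap_ob (pb_dom f).
Proof. by apply: sig_eq; rewrite /= !fdom. Qed.

Lemma pbmap_cod f : pb_cod (pbmap_mor f) = pbmap_ob (pb_cod f).
Proof. by apply: sig_eq; rewrite /= !fcod. Qed.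

Lemma pbmap_id x : pbmap_mor (pb_idm x) = pb_idm (pbmap_ob x).
Proof. by apply: sig_eq; rewrite /= !fid. Qed.

Lemma pbmap_comp g f e e' :
  pbmap_mor (@pb_comp _ _ _ _ _ g f e) =
  @pb_comp _ _ _ _ _ (pbmap_mor g) (pbmap_mor f) e'.
Proof. by apply: sig_eq; congr pair; exact: fcomp. Qed.

Definition pullback_map : functor (pullback F G) (pullback F' G') :=
  @MkFun (pullback F G) (pullback F' G') pbmap_ob pbmap_mor
    pbmap_dom pbmap_cod pbmap_id pbmap_comp.

End PullbackMap.

(* A double category is an internal category in Cat.  Horizontal composition is *)
(* written in diagrammatic order: [hcomp (x, y)] is defined when the target   *)
(* of x is the source of y.  The unit and associativity axioms, which are     *)
(* equalities of functors, are spelled out on objects of D1 (horizontal       *)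
(* morphisms) and on morphisms of D1 (squares).                               *)

Record dblcat := DblCat {
  D0 : smallcat;
  D1 : smallcat;
  src : functor D1 D0;
  tgt : functor D1 D0;
  unt : functor D0 D1;
  hcomp : functor (pullback tgt src) D1;
  src_unt : compfun src unt = idfun_cat D0;
  tgt_unt : compfun tgt unt = idfun_cat D0;
  src_hcomp : compfun src hcomp = compfun src (pb1 tgt src);
  tgt_hcomp : compfun tgt hcomp = compfun tgt (pb2 tgt src);
  hunitl_ob : forall a x e, hcomp (exist _ (unt a, x) e) = x;
  hunitl_mor : forall a x e, fmor hcomp (exist _ (fmor unt a, x) e) = x;
  hunitr_ob : forall x a e, hcomp (exist _ (x, unt a) e) = x;
  hunitr_mor : forall x a e, fmor hcomp (exist _ (x, fmor unt a) e) = x;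
  hassoc_ob : forall x y z e1 e2 e3 e4,
    hcomp (exist _ (x, hcomp (exist _ (y, z) e1)) e2) =
    hcomp (exist _ (hcomp (exist _ (x, y) e3), z) e4);
  hassoc_mor : forall x y z e1 e2 e3 e4,
    fmor hcomp (exist _ (x, fmor hcomp (exist _ (y, z) e1)) e2) =
    fmor hcomp (exist _ (fmor hcomp (exist _ (x, y) e3), z) e4)
}.
Arguments src {d}.
Arguments tgt {d}.
Arguments unt {d}.
Arguments hcomp {d}.


Record dblfunctor (D E : dblcat) := MkDblFun {
  K0 : functor (D0 D) (D0 E);
  K1 : functor (D1 D) (D1 E);
  Ksrc : compfun src K1 = compfun K0 src;
  Ktgt : compfun tgt K1 = compfun K0 tgt;
  Kunt : compfun K1 unt = compfun unt K0;
  Khcomp_ob : forall x y e e',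
    K1 (hcomp (exist _ (x, y) e)) = hcomp (exist _ (K1 x, K1 y) e');
  Khcomp_mor : forall x y e e',
    fmor K1 (fmor hcomp (exist _ (x, y) e)) =
    fmor hcomp (exist _ (fmor K1 x, fmor K1 y) e')
}.

Arguments Khcomp_ob {D E} _ {x y} e e'.
Arguments Khcomp_mor {D E} _ {x y} e e'.

Lemma dblfunctor_eq D E (K L : dblfunctor D E) :
  K0 K = K0 L -> K1 K = K1 L -> K = L.
Proof.
case: K L => [k0 k1 a b c d f] [l0 l1 a' b' c' d' f'] /= e0 e1; subst l0 l1.
by f_equal; exact: Prop_irrelevance.
Qed.

Lemma iddbl_hcomp_ob (D : dblcat) x y e e' :
  hcomp (exist _ (x, y) e) = hcomp (exist _ (x, y) e') :> Ob (D1 D).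
Proof. by congr (hcomp _); exact: sig_eq. Qed.

Lemma iddbl_hcomp_mor (D : dblcat) x y e e' :
  fmor hcomp (exist _ (x, y) e) = fmor hcomp (exist _ (x, y) e') :> Mor (D1 D).
Proof. by congr (fmor hcomp _); exact: sig_eq. Qed.

Definition iddbl (D : dblcat) : dblfunctor D D :=
  @MkDblFun D D (idfun_cat _) (idfun_cat _)
    (etrans (compfunidr _) (esym (compfunidl _)))
    (etrans (compfunidr _) (esym (compfunidl _)))
    (etrans (compfunidl _) (esym (compfunidr _)))
    (@iddbl_hcomp_ob D) (@iddbl_hcomp_mor D).

Section Compdbl.
Variables (C D E : dblcat) (L : dblfunctor D E) (K : dblfunctor C D).
Let LK0 := compfun (K0 L) (K0 K).
Let LK1 := compfun (K1 L) (K1 K).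

Lemma compdbl_src : compfun src LK1 = compfun LK0 src.
Proof. by rewrite compfunA Ksrc -compfunA Ksrc compfunA. Qed.

Lemma compdbl_tgt : compfun tgt LK1 = compfun LK0 tgt.
Proof. by rewrite compfunA Ktgt -compfunA Ktgt compfunA. Qed.

Lemma compdbl_unt : compfun LK1 unt = compfun unt LK0.
Proof. by rewrite -compfunA Kunt compfunA Kunt -compfunA. Qed.

Lemma compdbl_hcomp_ob x y e e' :
  LK1 (hcomp (exist _ (x, y) e)) = hcomp (exist _ (LK1 x, LK1 y) e').
Proof.
have e1 : tgt (K1 K x) = src (K1 K y).
  have /= -> := congr1 (fun F => fob F x) (Ktgt K).
  by have /= -> := congr1 (fun F => fob F y) (Ksrc K); congr (K0 K _).
by rewrite /= (Khcomp_ob K e e1); exact: Khcomp_ob.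
Qed.

Lemma compdbl_hcomp_mor x y e e' :
  fmor LK1 (fmor hcomp (exist _ (x, y) e)) =
  fmor hcomp (exist _ (fmor LK1 x, fmor LK1 y) e').
Proof.
have e1 : fmor tgt (fmor (K1 K) x) = fmor src (fmor (K1 K) y).
  have /= -> := congr1 (fun F => fmor F x) (Ktgt K).
  by have /= -> := congr1 (fun F => fmor F y) (Ksrc K); congr (fmor (K0 K) _).
by rewrite /= (Khcomp_mor K e e1); exact: Khcomp_mor.
Qed.

Definition compdbl : dblfunctor C E :=
  MkDblFun compdbl_src compdbl_tgt compdbl_unt compdbl_hcomp_ob compdbl_hcomp_mor.

End Compdbl.

Lemma compdblidl A B (f : dblfunctor A B) : compdbl (iddbl B) f = f.
Proof. by apply: dblfunctor_eq; exact: functor_eq. Qed.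

Lemma compdblidr A B (f : dblfunctor A B) : compdbl f (iddbl A) = f.
Proof. by apply: dblfunctor_eq; exact: functor_eq. Qed.

Lemma compdblA A B C D
    (h : dblfunctor C D) (g : dblfunctor B C) (f : dblfunctor A B) :
  compdbl h (compdbl g f) = compdbl (compdbl h g) f.
Proof. by apply: dblfunctor_eq; exact: compfunA. Qed.

Definition DBLCAT : category := Category compdblidl compdblidr compdblA.

Section Vertical.
Variable C : smallcat.
Let I := idfun_cat C.

Lemma vert_tgt_hcomp : compfun I (pb1 I I) = compfun I (pb2 I I).
Proof.
by apply: functor_eq; apply: funext => -[[x y] e].
Qed.

Definition vert_ob : dblcat :=
  @DblCat C C I I I (pb1 I I) (compfunidl I) (compfunidl I) erefl vert_tgt_hcomp
    (fun _ _ e => e) (fun _ _ e => e)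
    (fun _ _ _ => erefl) (fun _ _ _ => erefl)
    (fun _ _ _ _ _ _ _ => erefl) (fun _ _ _ _ _ _ _ => erefl).
End Vertical.

Definition vert_hom (C D : smallcat) (F : functor C D) :
  dblfunctor (vert_ob C) (vert_ob D) :=
  @MkDblFun (vert_ob C) (vert_ob D) F F
    (etrans (compfunidl _) (esym (compfunidr _)))
    (etrans (compfunidl _) (esym (compfunidr _)))
    (etrans (compfunidr _) (esym (compfunidl _)))
    (fun _ _ _ _ => erefl) (fun _ _ _ _ => erefl).

Lemma vert_id (C : smallcat) : vert_hom (idfun_cat C) = iddbl (vert_ob C).
Proof. exact: dblfunctor_eq. Qed.

Lemma vert_comp (A B C : smallcat) (G : functor B C) (F : functor A B) :
  vert_hom (compfun G F) = compdbl (vert_hom G) (vert_hom F).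
Proof. exact: dblfunctor_eq. Qed.

Definition vert : Functor CAT DBLCAT :=
  @MkFunctor CAT DBLCAT vert_ob vert_hom vert_id vert_comp.

(* Weak equivalences and fibrations of double categories only involve the     *)
(* functors (N_h K)_n, so N_h is given levelwise, as functors DblCat -> Cat.  *)
(* [hchain D n] is the (n+1)-fold fibre product of copies of D1 over D0,      *)
(* together with the source functor of the first factor.                      *)
Fixpoint hchain (D : dblcat) (n : nat) : {C : smallcat & functor C (D0 D)} :=
  match n with
  | 0 => existT _ (D1 D) src
  | n'.+1 =>
      let p := projT2 (hchain D n') in
      existT _ (pullback tgt p) (compfun src (pb1 tgt p))
  end.

Definition hnerve_ob (D : dblcat) (n : nat) : smallcat :=
  match n with 0 => D0 D | n'.+1 => projT1 (hchain D n') end.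

Lemma hchain_mapS (D E : dblcat) (K : dblfunctor D E) (C C' : smallcat)
    (p : functor C (D0 D)) (p' : functor C' (D0 E)) (F : functor C C')
    (eF : compfun p' F = compfun (K0 K) p) :
  compfun (compfun src (pb1 tgt p')) (pullback_map (Ktgt K) eF) =
  compfun (K0 K) (compfun src (pb1 tgt p)).
Proof.
by apply: functor_eq; apply: funext => x /=;
  [have /= := congr1 (fun H => fob H (sval x).1) (Ksrc K)
  |have /= := congr1 (fun H => fmor H (sval x).1) (Ksrc K)].
Qed.

Fixpoint hchain_map (D E : dblcat) (K : dblfunctor D E) (n : nat) :
  {F : functor (projT1 (hchain D n)) (projT1 (hchain E n)) |
    compfun (projT2 (hchain E n)) F = compfun (K0 K) (projT2 (hchain D n))} :=
  match n with
  | 0 => exist _ (K1 K) (Ksrc K)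
  | n'.+1 =>
      let eF := svalP (hchain_map K n') in
      exist _ (pullback_map (Ktgt K) eF) (hchain_mapS eF)
  end.

Definition hnerve_hom (D E : dblcat) (K : dblfunctor D E) (n : nat) :
  functor (hnerve_ob D n) (hnerve_ob E n) :=
  match n with 0 => K0 K | n'.+1 => sval (hchain_map K n') end.

Lemma hchain_map_id (D : dblcat) n : sval (hchain_map (iddbl D) n) = idfun_cat _.
Proof.
elim: n => [//|n /=]; move: (svalP _) => /=; case: (hchain_map _ n) => /= F _ eF e.
by subst F; apply: functor_eq; apply: funext => x; apply: sig_eq; case: x => [[]].
Qed.

Lemma hchain_map_comp (C D E : dblcat) (L : dblfunctor D E) (K : dblfunctor C D) n :
  sval (hchain_map (compdbl L K) n) =
  compfun (sval (hchain_map L n)) (sval (hchain_map K n)).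
Proof.
elim: n => [//|n /=]; do 3 move: (svalP _) => /=.
case: (hchain_map (compdbl L K) n) => /= F _ e e' e'' eF; subst F.
by apply: functor_eq; apply: funext => x; exact: sig_eq.
Qed.

Lemma hnerve_id D n : hnerve_hom (iddbl D) n = idfun_cat _.
Proof. by case: n => [//|n]; exact: hchain_map_id. Qed.

Lemma hnerve_comp (C D E : dblcat) (L : dblfunctor D E) (K : dblfunctor C D) n :
  hnerve_hom (compdbl L K) n = compfun (hnerve_hom L n) (hnerve_hom K n).
Proof. by case: n => [//|n]; exact: hchain_map_comp. Qed.

Definition hnerve (n : nat) : Functor DBLCAT CAT :=
  @MkFunctor DBLCAT CAT (fun D => hnerve_ob D n) (fun _ _ K => hnerve_hom K n)
    (fun D => hnerve_id D n) (fun _ _ _ L K => hnerve_comp L K n).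

Record dmap (m n : nat) := MkDmap {
  dfun :> 'I_m.+1 -> 'I_n.+1;
  dmapP : {homo dfun : i j / (i <= j)%N}
}.

Lemma dmap_eq m n (a b : dmap m n) : dfun a = dfun b -> a = b.
Proof.
by case: a b => [a pa] [b pb] /= e; subst b; congr MkDmap; exact: Prop_irrelevance.
Qed.

Definition dmap_id n : dmap n n := MkDmap (fun i j h => h : (id i <= id j)%N).

Definition dmap_comp m n p (a : dmap n p) (b : dmap m n) : dmap m p :=
  MkDmap (fun i j h => dmapP a (dmapP b h) : (a (b i) <= a (b j))%N).

Record sset := MkSset {
  sk :> nat -> Type;
  act : forall m n, dmap m n -> sk n -> sk m;
  act_id : forall n (x : sk n), act (dmap_id n) x = x;
  act_comp : forall m n p (a : dmap n p) (b : dmap m n) (x : sk p),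
    act (dmap_comp a b) x = act b (act a x)
}.
Arguments act {s m n}.

Record smap (X Y : sset) := MkSmap {
  sfun :> forall n, X n -> Y n;
  snat : forall m n (a : dmap m n) (x : X n), sfun (act a x) = act a (sfun x)
}.

Lemma smap_eq X Y (f g : smap X Y) : (forall n x, f n x = g n x) -> f = g.
Proof.
case: f g => [f pf] [g pg] /= e.
have ? : f = g by apply: functional_extensionality_dep => n; exact: funext.
by subst g; congr MkSmap; exact: Prop_irrelevance.
Qed.

Definition smap_id X : smap X X :=
  @MkSmap X X (fun _ => id) (fun _ _ _ _ => erefl).

Lemma smap_compP X Y Z (g : smap Y Z) (f : smap X Y) m n (a : dmap m n) (x : X n) :
  g m (f m (act a x)) = act a (g n (f n x)).
Proof. by rewrite !snat. Qed.

Definition smap_comp X Y Z (g : smap Y Z) (f : smap X Y) : smap X Z :=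
  @MkSmap X Z (fun n x => g n (f n x)) (smap_compP g f).

Lemma smap_idl X Y (f : smap X Y) : smap_comp (smap_id Y) f = f.
Proof. exact: smap_eq. Qed.

Lemma smap_idr X Y (f : smap X Y) : smap_comp f (smap_id X) = f.
Proof. exact: smap_eq. Qed.

Lemma smap_compA X Y Z W (h : smap Z W) (g : smap Y Z) (f : smap X Y) :
  smap_comp h (smap_comp g f) = smap_comp (smap_comp h g) f.
Proof. exact: smap_eq. Qed.

Definition SSET : category := Category smap_idl smap_idr smap_compA.

Section Preorder.
Variables (T : Type) (r : rel T) (rr : reflexive r) (rt : transitive r).

Definition preMor := {f : T * T | r f.1 f.2}.

Definition pre_comp (g f : preMor) (e : (sval g).1 = (sval f).2) : preMor :=
  exist _ ((sval f).1, (sval g).2)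
    (rt (svalP f) (eq_ind _ (fun x => r x (sval g).2) (svalP g) _ e)).

Lemma preMor_eq (f g : preMor) :
  (sval f).1 = (sval g).1 -> (sval f).2 = (sval g).2 -> f = g.
Proof.
by move=> e1 e2; apply: sig_eq; case: (sval f) (sval g) e1 e2 => [? ?] [? ?] /= -> ->.
Qed.

Definition preorder_cat : smallcat.
Proof.
refine (@SmallCat T preMor (fun f => (sval f).1) (fun f => (sval f).2)
  (fun x => exist _ (x, x) (rr x)) pre_comp
  (fun=> erefl) (fun=> erefl) (fun _ _ _ => erefl) (fun _ _ _ => erefl) _ _ _).
- by move=> x f e; exact: preMor_eq.
- by move=> f x e; exact: preMor_eq.
- by move=> h g f e1 e2 e3 e4; exact: preMor_eq.
Defined.
End Preorder.

Section PreorderMap.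
Variables (T U : Type) (r : rel T) (rr : reflexive r) (rt : transitive r).
Variables (q : rel U) (qr : reflexive q) (qt : transitive q).
Variables (h : T -> U) (hP : {homo h : x y / r x y >-> q x y}).

Definition preorder_map : functor (preorder_cat rr rt) (preorder_cat qr qt).
Proof.
refine (@MkFun (preorder_cat rr rt) (preorder_cat qr qt) h
  (fun f => exist _ (h (sval f).1, h (sval f).2) (hP (svalP f)))
  (fun=> erefl) (fun=> erefl) _ _).
- by move=> x; exact: preMor_eq.
- by move=> g f e e'; exact: preMor_eq.
Defined.
End PreorderMap.

Definition ordcat (n : nat) : smallcat :=
  @preorder_cat 'I_n.+1 (fun i j => i <= j)%N
    (fun i => leqnn i) (fun j i k => @leq_trans j i k).

Definition ordcat_map m n (a : dmap m n) : functor (ordcat m) (ordcat n) :=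
  preorder_map _ _ _ _ (@dmapP _ _ a).

Lemma ordcat_map_id n : ordcat_map (dmap_id n) = idfun_cat (ordcat n).
Proof.
by apply: functor_eq => //; apply: funext => f; exact: preMor_eq.
Qed.

Lemma ordcat_map_comp m n p (a : dmap n p) (b : dmap m n) :
  ordcat_map (dmap_comp a b) = compfun (ordcat_map a) (ordcat_map b).
Proof.
by apply: functor_eq => //; apply: funext => f; exact: preMor_eq.
Qed.

Definition nerve_ob (C : smallcat) : sset.
Proof.
refine (@MkSset (fun n => functor (ordcat n) C)
  (fun m n a x => compfun x (ordcat_map a)) _ _).
- by move=> n x; rewrite ordcat_map_id compfunidr.
- by move=> m n p a b x; rewrite ordcat_map_comp compfunA.
Defined.

Definition nerve_hom (C D : smallcat) (F : functor C D) :
  smap (nerve_ob C) (nerve_ob D) :=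
  @MkSmap (nerve_ob C) (nerve_ob D) (fun n x => compfun F x)
    (fun m n a x => compfunA F x (ordcat_map a)).

Definition nerve : Functor CAT SSET.
Proof.
refine (@MkFunctor CAT SSET nerve_ob nerve_hom _ _).
- by move=> C; apply: smap_eq => n x; exact: compfunidl.
- by move=> A B C G F; apply: smap_eq => n x; apply: esym; exact: compfunA.
Defined.

(* The nondegenerate simplices of Delta[n], ordered by the face relation, are *)
(* the nonempty subsets of [n] ordered by inclusion; Sd Delta[n] is the nerve *)
(* of this poset, and Sd is the colimit-preserving extension, so that its     *)
(* right adjoint is (Ex X)_n = SSet(Sd Delta[n], X).                          *)
Definition face (n : nat) := {A : {set 'I_n.+1} | A != finset.set0}.

Definition facecat (n : nat) : smallcat :=
  @preorder_cat (face n) (fun A B => val A \subset val B)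
    (fun A => subxx (val A)) (fun B A C => @fintype.subset_trans _ (val A) (val B) (val C)).

Lemma face_imP m n (a : dmap m n) (A : face m) : (a @: val A)%SET != finset.set0.
Proof. by rewrite imset_eq0 (valP A). Qed.

Definition face_im m n (a : dmap m n) (A : face m) : face n :=
  exist _ (a @: val A)%SET (face_imP a A).

Lemma face_im_homo m n (a : dmap m n) :
  {homo face_im a : A B / val A \subset val B}.
Proof. by move=> A B; exact: imsetS. Qed.

Definition facecat_map m n (a : dmap m n) : functor (facecat m) (facecat n) :=
  preorder_map _ _ _ _ (@face_im_homo _ _ a).

Lemma facecat_map_id n : facecat_map (dmap_id n) = idfun_cat (facecat n).
Proof.
have e : face_im (dmap_id n) = id.
  by apply: funext => A; apply: val_inj; rewrite /= imset_id.
apply: functor_eq => //; apply: funext => f.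
by apply: preMor_eq; rewrite /= e.
Qed.

Lemma facecat_map_comp m n p (a : dmap n p) (b : dmap m n) :
  facecat_map (dmap_comp a b) = compfun (facecat_map a) (facecat_map b).
Proof.
have e : face_im (dmap_comp a b) = fun A => face_im a (face_im b A).
  by apply: funext => A; apply: val_inj; rewrite /= -imset_comp.
apply: functor_eq => //; apply: funext => f.
by apply: preMor_eq; rewrite /= e.
Qed.

Definition sd (n : nat) : sset := nerve_ob (facecat n).
Definition sd_map m n (a : dmap m n) : smap (sd m) (sd n) :=
  nerve_hom (facecat_map a).

Definition ex_ob (X : sset) : sset.
Proof.
refine (@MkSset (fun n => smap (sd n) X) (fun m n a x => smap_comp x (sd_map a)) _ _).
- move=> n x; apply: smap_eq => k y /=; congr (x k _).
  by rewrite facecat_map_id compfunidl.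
- move=> m n p a b x; apply: smap_eq => k y /=; congr (x k _).
  by rewrite facecat_map_comp compfunA.
Defined.

Definition ex_hom (X Y : sset) (f : smap X Y) : smap (ex_ob X) (ex_ob Y).
Proof.
refine (@MkSmap (ex_ob X) (ex_ob Y) (fun n x => smap_comp f x) _).
by move=> m n a x; exact: smap_eq.
Defined.

Definition ex : Functor SSET SSET.
Proof.
refine (@MkFunctor SSET SSET ex_ob ex_hom _ _).
- by move=> X; apply: smap_eq => n x; exact: smap_eq.
- by move=> X Y Z g f; apply: smap_eq => n x; exact: smap_eq.
Defined.

Lemma dmap_idr m n (x : dmap m n) : dmap_comp x (dmap_id m) = x.
Proof. exact: dmap_eq. Qed.

Lemma dmap_compA m n p q (x : dmap p q) (a : dmap n p) (b : dmap m n) :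
  dmap_comp x (dmap_comp a b) = dmap_comp (dmap_comp x a) b.
Proof. exact: dmap_eq. Qed.

Definition simplex (n : nat) : sset :=
  @MkSset (fun m => dmap m n) (fun _ _ b x => dmap_comp x b)
    (fun m => @dmap_idr m n) (fun _ _ _ a b x => dmap_compA x a b).

Definition in_horn n (k : 'I_n.+1) m (x : dmap m n) :=
  exists2 j : 'I_n.+1, j != k & forall i, x i != j.

Lemma in_horn_act n (k : 'I_n.+1) m p (b : dmap m p) (x : dmap p n) :
  in_horn k x -> in_horn k (dmap_comp x b).
Proof. by case=> j jk xj; exists j => // i /=; exact: xj. Qed.

Definition horn n (k : 'I_n.+1) : sset.
Proof.
refine (@MkSset (fun m => {x : dmap m n | in_horn k x})
  (fun _ _ b x => exist _ (dmap_comp (sval x) b) (in_horn_act b (svalP x))) _ _).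
- by move=> m x; apply: sig_eq; exact: dmap_eq.
- by move=> m p q a b x; apply: sig_eq; exact: dmap_eq.
Defined.

Definition horn_incl n (k : 'I_n.+1) : smap (horn k) (simplex n) :=
  @MkSmap (horn k) (simplex n) (fun _ x => sval x) (fun _ _ _ _ => erefl).

Definition kan_fibration : hom_class SSET := fun X Y p =>
  forall (n : nat) (k : 'I_n.+2), @llp SSET _ _ _ _ (horn_incl k) p.

Section Realization.
Variable R : realType.
Local Open Scope classical_set_scope.
Local Open Scope ring_scope.

Definition stdsimplex (n : nat) : set 'rV[R]_n.+1 :=
  [set t | (forall i, 0 <= t ord0 i) /\ \sum_i t ord0 i = 1].

Arguments stdsimplex : clear implicits.

Definition push_mx m n (a : dmap m n) (t : 'rV[R]_m.+1) : 'rV[R]_n.+1 :=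
  \row_j \sum_(i | a i == j) t ord0 i.

Lemma push_mxP m n (a : dmap m n) (t : stdsimplex m) :
  push_mx a (val t) \in stdsimplex n.
Proof.
have [t0 t1] := set_mem (valP t); apply/mem_set; split=> [j|].
  by rewrite mxE; apply: sumr_ge0 => i _; exact: t0.
rewrite -[RHS]t1 [RHS](partition_big a predT) //=.
by apply: eq_bigr => j _; rewrite mxE.
Qed.

Definition push m n (a : dmap m n) (t : stdsimplex m) : stdsimplex n :=
  exist _ (push_mx a (val t)) (push_mxP a t).

(* The disjoint union, over all n and all x in X_n, of topological n-simplices *)
Definition prerealization (X : sset) :=
  {p : {n : nat & {classic (X n)}} & stdsimplex (projT1 p)}.

HB.instance Definition _ X := Topological.on (prerealization X).

Definition rpoint (X : sset) n (x : X n) (t : stdsimplex n) : prerealization X :=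
  existT (fun p : {n : nat & {classic (X n)}} => set_type (stdsimplex (projT1 p)))
    (existT _ n x) t.

Variant glue (X : sset) : prerealization X -> prerealization X -> Prop :=
  Glue m n (a : dmap m n) (x : X n) (t : stdsimplex m) :
    glue (rpoint (act a x) t) (rpoint x (push a t)).

Definition glued (X : sset) (p q : prerealization X) : bool :=
  `[< clos_refl_sym_trans _ (@glue X) p q >].

Lemma glued_refl X : reflexive (@glued X).
Proof. by move=> p; apply/asboolP; exact: rst_refl. Qed.

Lemma glued_sym X : symmetric (@glued X).
Proof. by move=> p q; apply/asboolP/asboolP; exact: rst_sym. Qed.

Lemma glued_trans X : transitive (@glued X).
Proof.
by move=> q p s /asboolP pq /asboolP qs; apply/asboolP; exact: rst_trans pq qs.
Qed.

Canonical glued_equiv X :=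
  EquivRel (@glued X) (@glued_refl X) (@glued_sym X) (@glued_trans X).

Definition realization (X : sset) : Type :=
  quotient_topology {eq_quot (@glued X)}%qT.

HB.instance Definition _ X := Topological.on (realization X).
HB.instance Definition _ X := Quotient.on (realization X).

Definition prerealization_map X Y (f : smap X Y) (p : prerealization X) :
    prerealization Y :=
  let: existT (existT n x) t := p in rpoint (f n x) t.

Definition realization_map X Y (f : smap X Y) (c : realization X) :
    realization Y :=
  (\pi_(realization Y) (prerealization_map f (repr c)))%qT.

Lemma realization_map_pi X Y (f : smap X Y) (p : prerealization X) :
  realization_map f (\pi_(realization X) p)%qT =
  (\pi_(realization Y) (prerealization_map f p))%qT.
Proof.
rewrite /realization_map; apply/eqquotP/asboolP.
have : glued (repr (\pi_(realization X) p)%qT) p.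
  apply/(@eqquotP _ (glued_equiv X)).
  exact: (reprK (\pi_(realization X) p)%qT).
move: (repr _) => q /asboolP; elim=> [_ _ [m n a x t]|{}q|{}q s _|{}q s u _ qs _ su].
- by rewrite /= snat; apply: rst_step; exact: Glue.
- exact: rst_refl.
- exact: rst_sym.
- exact: rst_trans qs su.
Qed.

Definition unit_interval : set R := `[0, 1].

Definition joined (T : topologicalType) (x y : T) :=
  exists g : unit_interval -> T,
    [/\ continuous g, forall s, val s = 0 -> g s = x
                    & forall s, val s = 1 -> g s = y].

Definition cube (n : nat) : set 'rV[R]_n :=
  [set u | forall i, 0 <= u ord0 i <= 1].

Arguments cube : clear implicits.

Definition on_boundary n (u : 'rV[R]_n) :=
  exists i, u ord0 i = 0 \/ u ord0 i = 1.

(* Representatives of elements of pi_n(T, x), and equality in pi_n(T, x).      *)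
Definition spheroid (T : topologicalType) n (x : T) (f : cube n -> T) :=
  continuous f /\ forall u, on_boundary (val u) -> f u = x.

Definition homotopic (T : topologicalType) n (x : T) (f g : cube n -> T) :=
  exists H : unit_interval * cube n -> T,
    [/\ continuous H,
        forall s u, val s = 0 -> H (s, u) = f u,
        forall s u, val s = 1 -> H (s, u) = g u
      & forall s u, on_boundary (val u) -> H (s, u) = x].

Definition pi0_bijective (T U : topologicalType) (phi : T -> U) :=
  (forall x x', joined (phi x) (phi x') -> joined x x') /\
  (forall y, exists x, joined (phi x) y).

Definition pi_bijective (T U : topologicalType) (phi : T -> U) n (x : T) :=
  (forall f g : cube n -> T, spheroid x f -> spheroid x g ->
     homotopic (phi x) (phi \o f) (phi \o g) -> homotopic x f g) /\
  (forall h : cube n -> U, spheroid (phi x) h ->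
     exists2 f : cube n -> T, spheroid x f & homotopic (phi x) (phi \o f) h).

Definition weak_homotopy_equivalence (T U : topologicalType) (phi : T -> U) :=
  [/\ continuous phi, pi0_bijective phi
    & forall n x, (0 < n)%N -> pi_bijective phi n x].

(* A map of simplicial sets is a weak equivalence when its geometric          *)
(* realization is a weak homotopy equivalence.                                *)
Definition simplicial_weq : hom_class SSET :=
  fun X Y f => weak_homotopy_equivalence (realization_map f).

Definition thomason_weq : hom_class CAT :=
  fun C D F => simplicial_weq (Fhom ex (Fhom ex (Fhom nerve F))).

Definition thomason_fib : hom_class CAT :=
  fun C D F => kan_fibration (Fhom ex (Fhom ex (Fhom nerve F))).

Definition thomason : model_classes CAT :=
  model_of_weq_fib thomason_weq thomason_fib.

Definition transferred_weq : hom_class DBLCAT :=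
  fun D E K => forall n, thomason_weq (Fhom (hnerve n) K).

Definition transferred_fib : hom_class DBLCAT :=
  fun D E K => forall n, thomason_fib (Fhom (hnerve n) K).

Definition transferred : model_classes DBLCAT :=
  model_of_weq_fib transferred_weq transferred_fib.

End Realization.

Arguments stdsimplex : clear implicits.
Arguments cube : clear implicits.

(* Main.v *)
(* Every iterated fibre product of copies of C over C along identities        *)
(* projects isomorphically onto C, so each (N_h (V F))_n is isomorphic to F   *)
(* in the arrow category of Cat.  Kan fibrations and weak equivalences of     *)
(* simplicial sets are invariant under isomorphism of arrows, the latter      *)
(* because realization turns isomorphisms into homeomorphisms; hence V        *)
(* preserves and reflects weak equivalences and fibrations.  For              *)
(* cofibrations, V is left adjoint to D |-> D0, so V F lifts against K iff F  *)
(* lifts against K0 = (N_h K)_0; conversely V is full and faithful, so a lift *)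
(* of V F against V p comes from a lift of F against p.                       *)

From mathcomp Require Import all_boot generic_quotient.
From mathcomp Require Import all_classical all_reals all_analysis.
Require Import Defs.

Set Implicit Arguments.
Unset Strict Implicit.
Unset Printing Implicit Defensive.

(** In [vert_ob C] all horizontal morphisms are identities, so its nerve is constant at [C] up to
    isomorphism, and each level of the nerve of [Fhom vert F] is isomorphic to [F] as an arrow of
    [CAT] ([hnerve_vert_arrow_iso]). Thomason weak equivalences and fibrations are invariant under
    such isomorphisms ([thomason_weq_arrow_iso], [thomason_fib_arrow_iso]), which settles these two
    classes.

    Cofibrations are defined by lifting against acyclic fibrations. If [K] is one in [DBLCAT], then
    [K0 K] is one in [CAT], and the adjunction between [vert] and [D0] turns lifts against [K0 K]
    into lifts against [K] ([llp_vert]). Conversely [vert] preserves acyclic fibrations and, being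
    fully faithful, reflects lifts ([llp_reflect]). *)

(** * Isomorphic arrows and lifting properties *)

Definition is_iso (M : category) (A B : ob M) (f : hom A B) :=
  exists g : hom B A, ccomp g f = cid A /\ ccomp f g = cid B.

Lemma is_iso_id (M : category) (A : ob M) : is_iso (cid A).
Proof. by exists (cid A); rewrite ccompidl. Qed.

Lemma is_iso_comp (M : category) (A B C : ob M) (g : hom B C) (f : hom A B) :
  is_iso g -> is_iso f -> is_iso (ccomp g f).
Proof.
move=> [g' [g'g gg']] [f' [f'f ff']]; exists (ccomp f' g'); split.
  by rewrite ccompA -(ccompA f') g'g ccompidr f'f.
by rewrite ccompA -(ccompA g) ff' ccompidr gg'.
Qed.

Definition arrow_iso (M : category) (A B A' B' : ob M)
    (f : hom A B) (f' : hom A' B') :=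
  exists a b, [/\ @is_iso M A A' a, @is_iso M B B' b & ccomp f' a = ccomp b f].

Lemma arrow_iso_sym (M : category) (A B A' B' : ob M)
    (f : hom A B) (f' : hom A' B') : arrow_iso f f' -> arrow_iso f' f.
Proof.
move=> [a [b [[a' [a'a aa']] [b' [b'b bb']] e]]]; exists a', b'; split.
- by exists a.
- by exists b.
- by rewrite -[LHS]ccompidl -b'b -ccompA (ccompA b) -e -ccompA aa' ccompidr.
Qed.

Lemma Fhom_arrow_iso (M N : category) (F : Functor M N) (A B A' B' : ob M)
    (f : hom A B) (f' : hom A' B') :
  arrow_iso f f' -> arrow_iso (Fhom F f) (Fhom F f').
Proof.
have Fiso (X Y : ob M) (h : hom X Y) : is_iso h -> is_iso (Fhom F h).
  by move=> [k [kh hk]]; exists (Fhom F k); rewrite -!Fhom_comp kh hk !Fhom_id.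
move=> [a [b [ia ib e]]]; exists (Fhom F a), (Fhom F b).
by split; [exact: Fiso|exact: Fiso|rewrite -!Fhom_comp e].
Qed.

(** A square against [p'] is carried to one against [p] by the inverse isomorphisms; its lift is
    carried back by [a]. *)
Lemma llp_arrow_iso (M : category) (A B X Y X' Y' : ob M) (i : hom A B)
    (p : hom X Y) (p' : hom X' Y') :
  arrow_iso p p' -> llp i p -> llp i p'.
Proof.
move=> [a [b [[a' [a'a aa']] [b' [b'b bb']] e]]] ip u v e'.
have pa' : ccomp p a' = ccomp b' p'.
  by rewrite -[LHS]ccompidl -b'b -ccompA (ccompA b) -e -ccompA aa' ccompidr.
have [|h [hi ph]] := ip (ccomp a' u) (ccomp b' v).
  by rewrite ccompA pa' -ccompA e' ccompA.
exists (ccomp a h); split.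
  by rewrite -ccompA hi ccompA aa' ccompidl.
by rewrite ccompA e -ccompA ph ccompA bb' ccompidl.
Qed.

Lemma kan_fibration_arrow_iso (X Y X' Y' : ob SSET) (p : hom X Y)
    (p' : hom X' Y') :
  arrow_iso p p' -> kan_fibration p -> kan_fibration p'.
Proof. by move=> pp' kp n k; exact: (llp_arrow_iso pp'). Qed.

(** * Invariance of Thomason weak equivalences and fibrations *)

Section WeakEquivalence.
Variable R : realType.
Local Open Scope classical_set_scope.

Lemma realization_map_continuous (X Y : sset) (f : smap X Y) :
  continuous (@realization_map R X Y f).
Proof.
apply/quotient_continuous.
have -> : realization_map f \o \pi_(realization R X)%qT =
    \pi_(realization R Y)%qT \o @prerealization_map R X Y f.
  by apply: funext => p; exact: realization_map_pi.
move=> p; apply: continuous_comp; last exact: pi_continuous.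
(* On the summand of x the map is the inclusion of the summand of f n x, so   *)
(* both neighbourhood filters reduce to the one of t in the simplex.          *)
by case: p => -[n x] t U nU; exact nU.
Qed.

Lemma realization_map_id (X : sset) (c : realization R X) :
  realization_map (smap_id X) c = c.
Proof.
rewrite -[c]reprK realization_map_pi; congr (\pi_(realization R X) _)%qT.
by case: (repr c) => -[n x] t.
Qed.

Lemma realization_map_comp (X Y Z : sset) (g : smap Y Z) (f : smap X Y)
    (c : realization R X) :
  realization_map (smap_comp g f) c = realization_map g (realization_map f c).
Proof.
rewrite -[c]reprK (realization_map_pi f) !realization_map_pi.
congr (\pi_(realization R Z) _)%qT.
by case: (repr c) => -[n x] t.
Qed.

Lemma joined_image (T U : topologicalType) (f : T -> U) (x y : T) :
  continuous f -> joined R x y -> joined R (f x) (f y).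
Proof.
move=> cf [g [cg g0 g1]]; exists (f \o g); split=> [s|s s0|s s1] /=.
- exact: continuous_comp (cg s) (cf _).
- by rewrite g0.
- by rewrite g1.
Qed.

Lemma spheroid_image (T U : topologicalType) (f : T -> U) n (x : T)
    (g : cube R n -> T) :
  continuous f -> spheroid x g -> spheroid (f x) (f \o g).
Proof.
move=> cf [cg gx]; split=> [u|u /gx /= -> //].
exact: continuous_comp (cg u) (cf _).
Qed.

Lemma homotopic_image (T U : topologicalType) (f : T -> U) n (x : T)
    (g h : cube R n -> T) :
  continuous f -> homotopic x g h -> homotopic (f x) (f \o g) (f \o h).
Proof.
move=> cf [H [cH H0 H1 Hx]]; exists (f \o H); split=> [s|s u e|s u e|s u e] /=.
- exact: continuous_comp (cH s) (cf _).
- by rewrite H0.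
- by rewrite H1.
- by rewrite Hx.
Qed.

(** Since [psi] is [b \o phi \o a'], each condition on [psi] at a basepoint [y] is the condition on
    [phi] at [a' y], with paths, spheroids and homotopies transported along the four continuous
    maps. *)
Lemma weak_homotopy_equivalence_homeo (T U T' U' : topologicalType)
    (phi : T -> U) (psi : T' -> U') (a : T -> T') (a' : T' -> T)
    (b : U -> U') (b' : U' -> U) :
  continuous a -> continuous a' -> continuous b -> continuous b' ->
  cancel a' a -> cancel b b' -> cancel b' b ->
  (forall x, psi (a x) = b (phi x)) ->
  weak_homotopy_equivalence R phi -> weak_homotopy_equivalence R psi.
Proof.
move=> ca ca' cb cb' a'K bK b'K e [cphi [inj0 surj0] bij].
have b'psi y : b' (psi y) = phi (a' y) by rewrite -{1}(a'K y) e bK.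
have psiE : psi = b \o (phi \o a').
  by apply: funext => y /=; rewrite -b'psi b'K.
split.
- rewrite psiE => y.
  exact: continuous_comp (continuous_comp (ca' y) (cphi _)) (cb _).
- split=> [y y' /(joined_image cb')|z].
    by rewrite !b'psi => /inj0 /(joined_image ca); rewrite !a'K.
  have [x /(joined_image cb)] := surj0 (b' z).
  by rewrite b'K -e; exists (a x).
- move=> n y n0; have [injn surjn] := bij n (a' y) n0.
  split=> [f g sf sg /(homotopic_image cb')|h /(spheroid_image cb')].
    have E k : b' \o (psi \o k) = phi \o (a' \o k) :> (cube R n -> U).
      by apply: funext => u; exact: b'psi.
    rewrite !E b'psi => /injn H.
    have /(homotopic_image ca) := H (spheroid_image ca' sf) (spheroid_image ca' sg).
    have E' k : a \o (a' \o k) = k :> (cube R n -> T').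
      by apply: funext => u; exact: a'K.
    by rewrite !E' a'K.
  rewrite b'psi => /surjn [f sf /(homotopic_image cb)].
  have -> : b \o (b' \o h) = h by apply: funext => u; exact: b'K.
  have -> : b \o (phi \o f) = psi \o (a \o f).
    by apply: funext => u /=; rewrite e.
  rewrite -e a'K => H; exists (a \o f) => //.
  by have := spheroid_image ca sf; rewrite a'K.
Qed.

Lemma simplicial_weq_arrow_iso (X Y X' Y' : ob SSET) (f : hom X Y)
    (f' : hom X' Y') :
  arrow_iso f f' -> simplicial_weq R f -> simplicial_weq R f'.
Proof.
move=> [a [b [[a' [a'a aa']] [b' [b'b bb']] e]]].
have K (Z Z' : sset) (g : smap Z Z') (h : smap Z' Z) : smap_comp h g = smap_id Z ->
    cancel (@realization_map R _ _ g) (realization_map h).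
  by move=> hg c; rewrite -realization_map_comp hg realization_map_id.
apply: weak_homotopy_equivalence_homeo; try exact: realization_map_continuous.
- exact: (K _ _ _ _ aa').
- exact: (K _ _ _ _ b'b).
- exact: (K _ _ _ _ bb').
- by move=> c; rewrite -!realization_map_comp; congr (realization_map _ c).
Qed.

Lemma thomason_weq_arrow_iso (C D C' D' : ob CAT) (F : hom C D)
    (F' : hom C' D') :
  arrow_iso F F' -> thomason_weq R F -> thomason_weq R F'.
Proof.
by move=> FF'; apply: simplicial_weq_arrow_iso; do 3 apply: Fhom_arrow_iso.
Qed.

End WeakEquivalence.

Lemma thomason_fib_arrow_iso (C D C' D' : ob CAT) (F : hom C D)
    (F' : hom C' D') :
  arrow_iso F F' -> thomason_fib F -> thomason_fib F'.
Proof.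
by move=> FF'; apply: kan_fibration_arrow_iso; do 3 apply: Fhom_arrow_iso.
Qed.

(** * Nerve levels of a vertical double category *)

(** Together with [pullback_ext], this is the universal property of the pullback in [CAT]. *)
Lemma pullback_lift (X A B C : smallcat) (F : functor A C) (G : functor B C)
    (P : functor X A) (Q : functor X B) :
  compfun F P = compfun G Q ->
  exists H : functor X (pullback F G),
    compfun (pb1 F G) H = P /\ compfun (pb2 F G) H = Q.
Proof.
move=> e.
have eo x : F (P x) = G (Q x) by exact: (congr1 (fun K => fob K x) e).
have em f : fmor F (fmor P f) = fmor G (fmor Q f).
  exact: (congr1 (fun K => fmor K f) e).
unshelve eexists.
  refine (@MkFun X (pullback F G) (fun x => exist _ (P x, Q x) (eo x))
    (fun f => exist _ (fmor P f, fmor Q f) (em f)) _ _ _ _).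
  - by move=> f; apply: sig_eq; rewrite /= !fdom.
  - by move=> f; apply: sig_eq; rewrite /= !fcod.
  - by move=> x; apply: sig_eq; rewrite /= !fid.
  - by move=> g f e1 e2; apply: sig_eq; congr pair; exact: fcomp.
by split; exact: functor_eq.
Qed.

Lemma pullback_ext (X A B C : smallcat) (F : functor A C) (G : functor B C)
    (H K : functor X (pullback F G)) :
  compfun (pb1 F G) H = compfun (pb1 F G) K ->
  compfun (pb2 F G) H = compfun (pb2 F G) K -> H = K.
Proof.
move=> e1 e2; apply: functor_eq; apply: funext => x; apply: sig_eq.
  have /= := congr1 (fun L => fob L x) e1; have /= := congr1 (fun L => fob L x) e2.
  by case: (sval _) (sval _) => [? ?] [? ?] /= -> ->.
have /= := congr1 (fun L => fmor L x) e1; have /= := congr1 (fun L => fmor L x) e2.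
by case: (sval _) (sval _) => [? ?] [? ?] /= -> ->.
Qed.

(** Isomorphisms are stable under base change: the inverse of [pb1] has components the identity and
    [compfun G' F], where [G'] is the inverse of [G]. *)
Lemma pb1_is_iso (A B C : smallcat) (F : functor A C) (G : functor B C) :
  @is_iso CAT _ _ G -> @is_iso CAT _ _ (pb1 F G).
Proof.
move=> [G' [/= G'G GG']].
have [|H [H1 H2]] := @pullback_lift A _ _ _ F G (idfun_cat A) (compfun G' F).
  by rewrite compfunidr compfunA GG' compfunidl.
exists H; split=> //=; apply: pullback_ext.
  by rewrite compfunA H1 compfunidl compfunidr.
rewrite compfunA H2 compfunidr -compfunA.
have -> : compfun F (pb1 F G) = compfun G (pb2 F G).
  by apply: functor_eq; apply: funext => x; exact: (svalP x).
by rewrite compfunA G'G compfunidl.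
Qed.

(** Here [src] is the identity, and [pb1] at each stage is a base change of the projection from the
    previous stage. *)
Lemma hchain_vert_is_iso (C : smallcat) n :
  @is_iso CAT _ _ (projT2 (hchain (vert_ob C) n)).
Proof.
elim: n => [|n IHn]; first exact: (@is_iso_id CAT).
apply: (@is_iso_comp CAT); first exact: (@is_iso_id CAT).
exact: pb1_is_iso.
Qed.

(** In positive degree the isomorphisms are the projections to [D0]; the proof component of
    [hchain_map] is their naturality. *)
Lemma hnerve_vert_arrow_iso (C D : ob CAT) (F : hom C D) n :
  arrow_iso (Fhom (hnerve n) (Fhom vert F)) F.
Proof.
case: n => [|n].
  exists (cid (C : ob CAT)), (cid (D : ob CAT)).
  by split; [exact: is_iso_id|exact: is_iso_id|rewrite ccompidl ccompidr].
exists (projT2 (hchain (vert_ob C) n)), (projT2 (hchain (vert_ob D) n)).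
split; [exact: hchain_vert_is_iso|exact: hchain_vert_is_iso|].
exact/esym/(svalP (hchain_map (vert_hom F) n)).
Qed.

(** * The adjunction between [vert] and [D0], and the theorem *)

Lemma vert_K1 (C : smallcat) (E : dblcat) (K : dblfunctor (vert_ob C) E) :
  K1 K = compfun unt (K0 K).
Proof. by rewrite -(Kunt K); exact/esym/compfunidr. Qed.

Lemma vert_ext (C : smallcat) (E : dblcat) (K L : dblfunctor (vert_ob C) E) :
  K0 K = K0 L -> K = L.
Proof. by move=> e; apply: dblfunctor_eq => //; rewrite !vert_K1 e. Qed.

(** With [vert_ext], this is the bijection on hom-sets making [vert] left adjoint to [D0]. *)
Lemma vert_transpose (C : smallcat) (E : dblcat) (F : functor C (D0 E)) :
  exists K : dblfunctor (vert_ob C) E, K0 K = F.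
Proof.
unshelve eexists.
  refine (@MkDblFun (vert_ob C) E F (compfun unt F) _ _ _ _ _).
  - by rewrite compfunA src_unt compfunidl; exact/esym/compfunidr.
  - by rewrite compfunA tgt_unt compfunidl; exact/esym/compfunidr.
  - exact: functor_eq.
  (* Composable horizontal morphisms of [vert_ob C] are equal, so both factors have unit images and
     the left unit law applies. *)
  - by move=> x y /= e e'; move: e'; rewrite -e => e'; rewrite hunitl_ob.
  - by move=> x y /= e e'; move: e'; rewrite -e => e'; rewrite hunitl_mor.
by [].
Qed.

Lemma llp_vert (C D : ob CAT) (F : hom C D) (X Y : ob DBLCAT) (K : hom X Y) :
  llp F (Fhom (hnerve 0) K) -> llp (Fhom vert F) K.
Proof.
move=> FK u v e.
have [|h [hF Kh]] := FK (K0 u) (K0 v); first exact: (congr1 (@K0 _ _) e).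
have [H H0] := @vert_transpose D X h.
by exists H; split; apply: vert_ext; rewrite /= H0.
Qed.

Lemma vert_bijective (C D : ob CAT) : bijective (@Fhom _ _ vert C D).
Proof. by exists (@K0 (vert_ob C) (vert_ob D)) => // K; exact: vert_ext. Qed.

Lemma vert_full_embedding : full_embedding vert.
Proof.
by split; [move=> C D /(congr1 D0)|exact: vert_bijective].
Qed.

(** Fullness pulls the lift back along [V]; faithfulness gives its two triangles. *)
Lemma llp_reflect (M N : category) (V : Functor M N) (A B X Y : ob M)
    (i : hom A B) (p : hom X Y) :
  (forall A B : ob M, bijective (@Fhom _ _ V A B)) ->
  llp (Fhom V i) (Fhom V p) -> llp i p.
Proof.
move=> Vbij ip u v e.
have [|h [hi ph]] := ip (Fhom V u) (Fhom V v); first by rewrite -!Fhom_comp e.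
have [V' _ VK] := Vbij B X; exists (V' h).
by split; apply: (bij_inj (Vbij _ _)); rewrite Fhom_comp VK.
Qed.

Theorem proposition7p16 (R : realType) :
  (forall (C D : ob CAT) (F : hom C D),
     [/\ weq (thomason R) F <-> weq (transferred R) (Fhom vert F),
         fib (thomason R) F <-> fib (transferred R) (Fhom vert F)
       & cof (thomason R) F <-> cof (transferred R) (Fhom vert F)]) /\
  extends_along vert (transferred R) (thomason R).
Proof.
have weqP (C D : ob CAT) (F : hom C D) :
    weq (thomason R) F <-> weq (transferred R) (Fhom vert F).
  (* Level 0 of the nerve of [Fhom vert F] is [F] by definition, which gives the converse. *)
  split=> [wF n|/(_ 0)//]; apply: thomason_weq_arrow_iso wF.
  exact/arrow_iso_sym/hnerve_vert_arrow_iso.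
have fibP (C D : ob CAT) (F : hom C D) :
    fib (thomason R) F <-> fib (transferred R) (Fhom vert F).
  split=> [fF n|/(_ 0)//]; apply: thomason_fib_arrow_iso fF.
  exact/arrow_iso_sym/hnerve_vert_arrow_iso.
have cofP (C D : ob CAT) (F : hom C D) :
    cof (thomason R) F <-> cof (transferred R) (Fhom vert F).
  split=> [cF X Y K wK fK|cF X Y p /weqP wp /fibP fp].
    (* The hypotheses on [K] are used at level 0, where they concern [K0 K]. *)
    by apply: llp_vert; apply: cF; [exact: wK|exact: fK].
  by apply: (llp_reflect vert_bijective); exact: cF.
split; first by move=> C D F.
split; first exact: vert_full_embedding.
by congr ModelClasses; apply: functional_extensionality_dep => C;
  apply: functional_extensionality_dep => D; apply: funext => F;
  apply: propext; apply: iff_sym; [exact: weqP|exact: fibP|exact: cofP].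
Qed.
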